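(* Let $(X,d_X,\mu_X)$ and $(Y,d_Y,\mu_Y)$ be (compact) metric measure spaces with $d_{GHP}(X,Y)<1/4$. Then for all $N\in\mathbb{N}$ (with $N\ge 1$), $$d_P(\theta^X_N,\theta^Y_N;d_\pi)\leq d_{GHP}(X,Y)^{1/2}.$$
   Context: A metric measure space is a triple $(X,d,\mu)$ with $(X,d)$ a compact metric space and $\mu$ a Borel probability measure on $X$. Prokhorov distance: let $\mu_1,\mu_2$ be Borel probability measures on a (pseudo-)metric space $(Z,d_Z)$. For a probability measure $\theta$ on $Z\times Z$ with marginals $\mu_1,\mu_2$ put $\Delta(\theta;d_Z)=\inf\{r>0:\theta(\{(z_1,z_2): d_Z(z_1,z_2)\le r\})\ge 1-r\}$, and let $d_P(\mu_1,\mu_2;d_Z)=\inf_\theta \Delta(\theta;d_Z)$ over all such $\theta$. Gromov-Hausdorff-Prokhorov distance: $d_{GHP}(X_1,X_2)=\inf d_P(\iota_{1*}\mu_1,\iota_{2*}\mu_2;d_Z)$, the infimum being over all compact metric spaces $Z$ and isometric (distance-preserving) embeddings $\iota_i:X_i\to Z$, $i=1,2$. Matrices: $M(N)$ is the space of real symmetric $N\times N$ matrices. For $A=(a_{ij}),B=(b_{ij})\in M(N)$, let $d_M(A,B)=\inf\{\rho>0:\exists\lambda\subset\{1,\dots,N\},\ |\lambda|<N\rho,\ |a_{ij}-b_{ij}|<\rho\ \forall i,j\notin\lambda\}$ (a pseudo-metric). The symmetric group $S_N$ acts on $M(N)$ by simultaneous permutation of rows and columns, and $d_\pi(A,B)=\min\{d_M(A,\pi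 B):\pi\in S_N\}$. $\mathbb{D}(N)\subset M(N)$ is the set of distance matrices (symmetric, non-negative entries, zero diagonal, $a_{ij}\le a_{ik}+a_{kj}$ for all $i,j,k$), with the restrictions of these pseudo-metrics; measures on $M(N)$, $\mathbb{D}(N)$ are Borel for the usual topology of matrices. For a metric measure space $(X,d,\mu)$ and $N\in\mathbb{N}$, $\theta_N^X$ is the distribution on $\mathbb{D}(N)$ of the random matrix $(d(x_i,x_j))_{1\le i,j\le N}$, where $x_1,\dots,x_N$ are sampled independently from $X$ according to $\mu$. *)

(* Defs.v *)
From HB Require Import structures.
From mathcomp Require Import all_boot all_order all_algebra all_fingroup.
From mathcomp Require Import all_classical all_reals all_analysis.
From mathcomp Require Import lra.
Import Order.TTheory GRing.Theory Num.Theory.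
Import numFieldNormedType.Exports.

Set Implicit Arguments.
Unset Strict Implicit.
Unset Printing Implicit Defensive.

Local Open Scope classical_set_scope.
Local Open Scope ring_scope.

(* The point is only there because [measurableType] extends [Pointed]; it is
   not a restriction, as a space carrying a probability measure, or receiving
   a map from such a space, is not empty. *)
#[short(type="pmetricType")]
HB.structure Definition PointedMetric (K : numDomainType) :=
  { M of Metric K M & isPointed M }.

Notation borel T := (@g_sigma_algebraType T (@open T)).

Record mmSpace (R : realType) := MMSpace {
  mm_space :> pmetricType R ;
  mm_compact : compact [set: mm_space] ;
  mm_measure : probability (borel mm_space) R }.

Definition pushforward_prob d d' (T : measurableType d) (T' : measurableType d')
    (R : realType) (P : probability T R) (f : T -> T')
    (mf : measurable_fun setT f) : probability T' R :=
  distribution P (mfun_Sub (mem_set mf)).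

Section Prokhorov.
Context d (T : measurableType d) (R : realType).

(* [T * T] carries the product sigma-algebra; it is the Borel sigma-algebra of
   the product space for all the spaces considered below, as they are second
   countable. *)
Definition is_coupling (mu1 mu2 : probability T R)
    (theta : probability (T * T)%type R) : Prop :=
  (forall A, measurable A -> theta (fst @^-1` A) = mu1 A) /\
  (forall A, measurable A -> theta (snd @^-1` A) = mu2 A).

Definition coupling_defect (dist : T -> T -> R)
    (theta : probability (T * T)%type R) : R :=
  inf [set r | 0 < r /\
    ((1 - r)%:E <= theta [set z | (dist z.1 z.2 <= r)%R])%E].

Definition dP (dist : T -> T -> R) (mu1 mu2 : probability T R) : R :=
  inf [set coupling_defect dist theta | theta in is_coupling mu1 mu2].

End Prokhorov.

Definition isometric_embedding (R : realType) (X Y : metricType R)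
    (f : X -> Y) : Prop := forall x y, mdist (f x) (f y) = mdist x y.

Lemma isometric_embedding_continuous (R : realType) (X Y : metricType R)
  (f : X -> Y) : isometric_embedding f -> continuous f.
Proof.
move=> isof x; apply/(@metricType_numDomainType.cvgrPdist_lt R) => e e0.
apply/metricType_numDomainType.nbhs_mdistP; exists e => // y /=.
by rewrite isof.
Qed.

Lemma continuous_borel_measurable (X Y : ptopologicalType) (f : X -> Y) :
  continuous f -> measurable_fun setT (f : borel X -> borel Y).
Proof.
move=> cf; apply: (@measurability _ _ (borel X) (borel Y) _ _ (@open Y)) => //.
move=> _ [B oB <-]; apply: sub_sigma_algebra; rewrite setTI.
by move/continuousP : cf; exact.
Qed.

Lemma isometric_embedding_measurable (R : realType) (X Y : pmetricType R)
  (f : X -> Y) : isometric_embedding f ->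
  measurable_fun setT (f : borel X -> borel Y).
Proof.
by move=> /isometric_embedding_continuous; exact: continuous_borel_measurable.
Qed.

Definition dGHP (R : realType) (X Y : mmSpace R) : R :=
  inf [set r : R | exists (Z : pmetricType R) (iX : X -> Z) (iY : Y -> Z)
      (hX : isometric_embedding iX) (hY : isometric_embedding iY),
    compact [set: Z] /\
    r = dP (T := borel Z) (@mdist R Z)
          (pushforward_prob (mm_measure X) (isometric_embedding_measurable hX))
          (pushforward_prob (mm_measure Y) (isometric_embedding_measurable hY))].

Section Matrices.
Context (R : realType) (N : nat).

Definition dM (A B : 'M[R]_N) : R :=
  inf [set rho | 0 < rho /\ exists l : {set 'I_N},
    #|l|%:R < N%:R * rho /\
    forall i j, i \notin l -> j \notin l -> `|A i j - B i j| < rho].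

(* The default value of the minimum is the one at the identity permutation. *)
Definition dpi (A B : 'M[R]_N) : R :=
  \big[Num.min/dM A B]_(s : 'S_N) dM A (row_perm s (col_perm s B)).

Definition distance_matrix : set 'M[R]_N :=
  [set A | [/\ A^T = A, forall i j, 0 <= A i j, forall i, A i i = 0 &
               forall i j k, A i j <= A i k + A k j]].

Definition distmx : Type := set_type distance_matrix.

HB.instance Definition _ := Topological.copy distmx (set_type distance_matrix).

Lemma distance_matrix0 : distance_matrix 0.
Proof. by split=> [|i j|i|i j k]; rewrite ?trmx0 ?mxE// addr0. Qed.

HB.instance Definition _ := isPointed.Build distmx
  (exist _ 0 (mem_set distance_matrix0)).

Definition dpi_distmx (A B : borel distmx) : R :=
  dpi (set_val (A : distmx)) (set_val (B : distmx)).

End Matrices.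

Section Sampling.
Context (R : realType).

Lemma measurable_tcons d (T : measurableType d) n :
  measurable_fun setT (fun p : T * n.-tuple T => [tuple of p.1 :: p.2]).
Proof. exact: measurable_cons. Qed.

(* The law of N independent samples of [P]. *)
Fixpoint prob_power d (T : measurableType d) (P : probability T R) (N : nat) :
    probability (N.-tuple T) R :=
  if N is n.+1 then
    pushforward_prob (P \x prob_power P n)%E (@measurable_tcons d T n)
  else \d_ [tuple].

Definition sample_matrix (X : pmetricType R) N (x : N.-tuple (borel X)) :
    'M[R]_N := \matrix_(i, j) mdist (tnth x i : X) (tnth x j).

Lemma sample_matrixP (X : pmetricType R) N (x : N.-tuple (borel X)) :
  distance_matrix (sample_matrix x).
Proof.
split.
- by apply/matrixP => i j; rewrite !mxE metric_sym.
- by move=> i j; rewrite mxE mdist_ge0.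
- by move=> i; rewrite mxE mdistxx.
- by move=> i j k; rewrite !mxE metric_triangle.
Qed.

Definition sample_distmx (X : pmetricType R) N (x : N.-tuple (borel X)) :
    borel (distmx R N) := exist _ (sample_matrix x) (mem_set (sample_matrixP x)).

Lemma open_countable_basisE (T : topologicalType) (B : set (set T)) (U : set T) :
  basis B -> open U -> U = \bigcup_(V in [set V | B V /\ V `<=` U]) V.
Proof.
move=> [_ Bb] oU; apply/seteqP; split=> [x Ux|x [V [_ VU] Vx]]; last exact: VU.
have [V [BV Vx] VU] := Bb x U (open_nbhs_nbhs (conj oU Ux)).
by exists V.
Qed.

Lemma countable_bigcup_measurable d (T : measurableType d) (I : Type)
    (D : set I) (F : I -> set T) :
  countable D -> (forall i, D i -> measurable (F i)) ->
  measurable (\bigcup_(i in D) F i).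
Proof.
move=> cD mF; rewrite bigcup_set_type; apply: countable_bigcupT_measurable.
  by move: cD; rewrite /countable (card_le_eql (card_setT D)).
by move=> i; apply: mF; exact: set_valP.
Qed.

Lemma mdist_lt_measurable (X : pmetricType R) (r : R) : compact [set: X] ->
  measurable ([set z | mdist (z.1 : X) z.2 < r] : set (borel X * borel X)).
Proof.
move=> /compact_second_countable[B cB [oB Bb]].
set S := [set z | _].
have -> : S = \bigcup_(V in [set V | (B `*` B) V /\ V.1 `*` V.2 `<=` S])
    (V.1 `*` V.2).
  apply/seteqP; split=> [[x y] /= xyr|z [V [_ VS] Vz]]; last exact: VS.
  pose e := (r - mdist x y) / 2.
  have e0 : 0 < e by rewrite divr_gt0// subr_gt0.
  have [V [BV Vx] Vr] := Bb x _ (nbhsx_ballx x e e0).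
  have [W [BW Wy] Wr] := Bb y _ (nbhsx_ballx y e e0).
  exists (V, W) => //; split => // -[x' y'] /= [/Vr xx' /Wr yy'].
  move: xx' yy'; rewrite !ballEmdist/= => xx' yy'.
  have := metric_triangle x' x y'; have := metric_triangle x y y'.
  rewrite (metric_sym x' x); rewrite /S/=; move: xx' yy'; rewrite /e; lra.
apply: countable_bigcup_measurable => [|V [[BV1 BV2] _]].
  apply: sub_countable (countableX cB cB).
  by apply: subset_card_le => V [].
apply: measurableX; apply: sub_sigma_algebra; exact: oB.
Qed.

Lemma mdist_tnth_measurable (X : pmetricType R) N (i j : 'I_N) :
  compact [set: X] ->
  measurable_fun setT
    (fun x : N.-tuple (borel X) => mdist (tnth x i : X) (tnth x j)).
Proof.
move=> cX; apply: (measurability _ (measurable_realfun.RGenInftyO.measurableE R)).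
move=> _ [_ [r ->] <-]; rewrite setTI.
have mij : measurable_fun setT
    (fun x : N.-tuple (borel X) => (tnth x i, tnth x j)).
  by apply: measurable_fun_pair; exact: measurable_tnth.
have := mij measurableT _ (mdist_lt_measurable r cX).
by rewrite setTI; congr measurable; apply/seteqP; split=> x /=;
  rewrite in_itv.
Qed.

Lemma borel_matrix_measurable d (T : measurableType d) N (f : T -> 'M[R]_N) :
  (forall i j, measurable_fun setT (fun t => f t i j)) ->
  forall U : set 'M[R]_N, open U -> measurable (f @^-1` U).
Proof.
move=> mf U oU.
pose box (ab : 'M[rat]_N * 'M[rat]_N) : set 'M[R]_N :=
  [set A | forall i j, ratr (ab.1 i j) < A i j < ratr (ab.2 i j)].
have -> : f @^-1` U = \bigcup_(ab in [set ab | box ab `<=` U]) (f @^-1` box ab).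
  apply/seteqP; split=> [t /= Uft|t [ab abU]]; last exact: abU.
  have /nbhs_ballP[e /= e0 eU] := open_nbhs_nbhs (conj oU Uft).
  have la i j : {q : rat | f t i j - e < ratr q < f t i j}.
    apply: cid; have [|q] := @rat_in_itvoo R (f t i j - e) (f t i j).
      by rewrite ltrBlDr ltrDl.
    by rewrite in_itv/= => ?; exists q.
  have lb i j : {q : rat | f t i j < ratr q < f t i j + e}.
    apply: cid; have [|q] := @rat_in_itvoo R (f t i j) (f t i j + e).
      by rewrite ltrDl.
    by rewrite in_itv/= => ?; exists q.
  exists (\matrix_(i, j) sval (la i j), \matrix_(i, j) sval (lb i j)).
    move=> A /= Abox; apply: eU; split => // i j.
    have := Abox i j; rewrite !mxE.
    case: (la i j) (lb i j) => a /= /andP[a1 a2] [b /= /andP[b1 b2]] /andP[aA Ab].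
    rewrite /ball/= distrC ltr_distl.
    by rewrite (lt_trans a1 aA) (lt_trans Ab b2).
  move=> i j; rewrite !mxE.
  by case: (la i j) (lb i j) => a /= /andP[_ ->] [b /= /andP[-> _]].
apply: countable_bigcup_measurable => // ab _.
rewrite [X in measurable X](_ : _ = \bigcap_(i in [set: 'I_N])
    \bigcap_(j in [set: 'I_N])
    ((fun t => f t i j) @^-1` `]ratr (ab.1 i j), ratr (ab.2 i j)[%classic)).
  apply: fin_bigcap_measurable => // i _; apply: fin_bigcap_measurable => // j _.
  by rewrite -[X in measurable X]setTI; exact: mf.
apply/seteqP; split=> [t /= h i _ j _|t h i j] /=.
  by rewrite in_itv/=; exact: h.
by have := h i I j I; rewrite /= in_itv.
Qed.

Lemma sample_distmx_measurable (X : mmSpace R) N :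
  measurable_fun setT (@sample_distmx X N).
Proof.
apply: (@measurability _ _ _ (borel (distmx R N)) _ _ open) => //.
move=> _ [_ [U oU <-] <-]; rewrite setTI.
have -> : @sample_distmx X N @^-1` (set_val @^-1` U) = @sample_matrix X N @^-1` U.
  by [].
apply: borel_matrix_measurable => // i j.
rewrite (_ : (fun x => _) = fun x : N.-tuple (borel X) =>
    mdist (tnth x i : X) (tnth x j)).
  by apply: mdist_tnth_measurable; exact: mm_compact.
by apply/funext => x; rewrite mxE.
Qed.

Definition thetaN (X : mmSpace R) (N : nat) : probability (borel (distmx R N)) R :=
  pushforward_prob (prob_power (mm_measure X) N) (@sample_distmx_measurable X N).

End Sampling.

(* Main.v *)
(* Given a coupling theta of the two measures in a common space Z with
   theta (d > r) <= r, sample N independent pairs from theta: their distance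
   matrices form a coupling of the two matrix laws. The expected number of pairs
   at distance > r is at most N r, so by Markov's inequality it is less than
   N sqrt r with probability at least 1 - sqrt r; the rows outside these pairs
   agree up to 2 r, and 2 r < sqrt r because r < 1/4. *)
Require Import Defs.
From HB Require Import structures.
From mathcomp Require Import all_boot all_order all_algebra all_fingroup.
From mathcomp Require Import all_classical all_reals all_analysis.
From mathcomp Require Import measurable_realfun lra.
Import Order.TTheory GRing.Theory Num.Theory.
Import numFieldNormedType.Exports.

Set Implicit Arguments.
Unset Strict Implicit.
Unset Printing Implicit Defensive.

Local Open Scope classical_set_scope.
Local Open Scope ring_scope.

(** * Independent samples: images, marginals, Markov's inequality *)

Lemma measurable_map_tuple d d' (T : measurableType d) (T' : measurableType d')
    (f : T -> T') n : measurable_fun setT f ->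
  measurable_fun setT (fun x : n.-tuple T => map_tuple f x).
Proof.
move=> mf; apply/measurable_fun_tnthP => i.
rewrite (_ : _ \o _ = f \o (@tnth _ T ^~ i)).
  by apply: measurableT_comp => //; exact: measurable_tnth.
by apply/funext => x /=; rewrite tnth_map.
Qed.

(** Induction on [n] through the product structure of [prob_power]. It serves both for the
    projections of a coupling and for an isometric embedding. *)
Lemma prob_power_map (R : realType) d d' (T : measurableType d)
    (T' : measurableType d') (P : probability T R) (Q : probability T' R)
    (f : T -> T') : measurable_fun setT f ->
  (forall A, measurable A -> P (f @^-1` A) = Q A) ->
  forall n A, measurable A ->
    prob_power P n ((fun x => map_tuple f x) @^-1` A) = prob_power Q n A.
Proof.
move=> mf PQ; elim=> [|n IH] A mA.
  rewrite /= !diracE; congr ((_ : bool)%:R%:E).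
  by apply/idP/idP; rewrite !inE /=; congr A; apply: val_inj.
rewrite /= /distribution /pushforward /=.
pose A' := (fun p : T' * n.-tuple T' => [tuple of p.1 :: p.2]) @^-1` A.
have mA' : measurable A'.
  by rewrite -[A']setTI; exact: (@measurable_tcons _ T' n).
rewrite -/A' /product_measure1.
(* The section at [x] of the pulled-back set is the pullback of the section of [A'] at [f x], so the
   induction hypothesis applies under the integral; a change of variables along [f] then gives the
   integral against [Q]. *)
transitivity (\int[P]_x ((prob_power Q n \o xsection A') \o f) x)%E.
  apply: eq_integral => x _ /=.
  rewrite -IH; last exact: measurable_xsection.
  congr (prob_power P n _); apply/seteqP; split => t /=;
    rewrite /xsection /= !inE /A' /=; congr A; exact: val_inj.
rewrite -[in LHS](preimage_setT f) -(ge0_integral_pushforward mf)//.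
- apply: eq_measure_integral => // C mC _; exact: PQ.
- exact: measurable_fun_xsection.
Qed.

Lemma prob_power_tnth (R : realType) d (T : measurableType d)
    (P : probability T R) n (i : 'I_n) (B : set T) : measurable B ->
  prob_power P n ((@tnth _ T ^~ i) @^-1` B) = P B.
Proof.
elim: n i => [[]//|n IH] i mB.
rewrite /= /distribution /pushforward /=.
have [j ->|->] := unliftP ord0 i.
  rewrite (_ : _ @^-1` _ = setT `*` ((@tnth _ T ^~ j) @^-1` B)).
    rewrite product_measure1E//; last first.
      by rewrite -[X in measurable X]setTI; exact: measurable_tnth.
    by rewrite -[RHS](IH j mB) /= probability_setT mul1e.
  by apply/seteqP; split => -[x t] /=; rewrite tnthS//; case.
rewrite (_ : _ @^-1` _ = B `*` setT).
  rewrite product_measure1E//.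
  by rewrite [X in (_ * X)%E](probability_setT (prob_power P n)) mule1.
by apply/seteqP; split => -[x t] /=; rewrite tnth0//; case.
Qed.

Lemma card_tnth_indic (R : pzRingType) (T : Type) n (t : n.-tuple T)
    (B : set T) :
  #|[set i | tnth t i \in B]%SET|%:R = \sum_(i < n) \1_B (tnth t i) :> R.
Proof.
rewrite -sum1_card natr_sum [in LHS]big_mkcond /=.
by apply: eq_bigr => i _; rewrite inE indicE; case: ifP.
Qed.

Lemma measurable_indic_tnth (R : realType) d (T : measurableType d) n
    (i : 'I_n) (B : set T) : measurable B ->
  measurable_fun setT (fun t : n.-tuple T => \1_B (tnth t i) : R).
Proof.
move=> mB; apply: (measurableT_comp (f := \1_B : T -> R)) => //.
exact: measurable_tnth.
Qed.

Lemma measurable_card_tnth (R : realType) d (T : measurableType d) n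
    (B : set T) : measurable B ->
  measurable_fun setT
    (fun t : n.-tuple T => #|[set i | tnth t i \in B]%SET|%:R : R).
Proof.
move=> mB; under eq_fun do rewrite card_tnth_indic.
by apply: measurable_sum => i; exact: measurable_indic_tnth.
Qed.

(** The number of samples in [B] is a sum of indicators, each of expectation [P B] by
    [prob_power_tnth]; hence its mean is [n * P B], and Markov's inequality applies. *)
Lemma prob_power_markov (R : realType) d (T : measurableType d)
    (P : probability T R) n (B : set T) (c : R) : measurable B -> 0 < c ->
  (c%:E * prob_power P n [set t | (c <= #|[set i | tnth t i \in B]%SET|%:R)%R]
    <= n%:R%:E * P B)%E.
Proof.
move=> mB c0.
pose S (t : n.-tuple T) : R := #|[set i | tnth t i \in B]%SET|%:R.
have -> : (n%:R%:E * P B = \int[prob_power P n]_t `|(S t)%:E|)%E.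
  under eq_integral do
    rewrite abse_EFin normr_nat card_tnth_indic -sumEFin.
  rewrite ge0_integral_sum//; last first.
    by move=> i; apply/measurable_EFinP; exact: measurable_indic_tnth.
  rewrite (eq_bigr (fun _ => P B)) => [|i _].
    by rewrite sumr_const card_ord mule_natl.
  rewrite -(prob_power_tnth P i mB) -[in RHS](setIT (_ @^-1` _)).
  rewrite -integral_indic//.
  by rewrite -[X in measurable X]setTI; exact: measurable_tnth.
have mS : measurable_fun setT (EFin \o S).
  by apply/measurable_EFinP; exact: measurable_card_tnth.
rewrite (_ : [set t | _] = setT `&` [set t | (c%:E <= `|(EFin \o S) t|)%E]).
  exact: le_integral_abse.
by rewrite setTI; apply/seteqP; split => t /=; rewrite normr_nat lee_fin.
Qed.

(* [X * Y] with the sup metric contains copies of [X] and [Y]; without such a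
   common space [dGHP X Y] would be the junk value [inf set0 = 0]. *)
Section sup_metric.
Context (R : realType) (X Y : pmetricType R).

Definition sup_dist (x y : X * Y) : R :=
  Num.max (mdist x.1 y.1) (mdist x.2 y.2).

Lemma sup_dist_ge0 x y : 0 <= sup_dist x y.
Proof. by rewrite le_max mdist_ge0. Qed.

Lemma sup_dist_positivity x y : sup_dist x y = 0 -> x = y.
Proof.
case: x y => [x1 x2] [y1 y2] xy0.
have : sup_dist (x1, x2) (y1, y2) <= 0 by rewrite xy0.
rewrite ge_max /= => /andP[xy1 xy2].
by congr pair; apply: mdist_positivity; apply/eqP;
  rewrite eq_le mdist_ge0 andbT.
Qed.

(** This puts the sup metric on the existing product structure, so that compactness of the product
    is inherited from the factors. *)
Lemma ball_sup_dist x d : ball x d = [set y | sup_dist x y < d].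
Proof.
apply/seteqP; split => y /=; rewrite /ball /= /prod_ball !ballEmdist /= gt_max.
  by case=> -> ->.
by case/andP.
Qed.

HB.instance Definition _ := PseudoMetric_isMetric.Build R (X * Y)%type
  sup_dist_ge0 sup_dist_positivity ball_sup_dist.

End sup_metric.

(** * Measurability of the distance and of matrix entries *)

Lemma measurable_mdist (R : realType) (X : pmetricType R) :
  compact [set: X] -> measurable_fun setT
    (fun z : borel X * borel X => mdist (z.1 : X) z.2).
Proof.
move=> cX; apply: (measurability _ (RGenInftyO.measurableE R)).
move=> _ [_ [r ->] <-]; rewrite setTI.
have := mdist_lt_measurable r cX.
by congr measurable; apply/seteqP; split=> x /=; rewrite in_itv.
Qed.

Lemma distmx_coord_measurable (R : realType) N (i j : 'I_N) :
  measurable_fun setT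
    (fun A : borel (distmx R N) => set_val (A : distmx R N) i j).
Proof.
apply: (measurability _ (RGenInftyO.measurableE R)).
move=> _ [_ [r ->] <-]; rewrite setTI.
apply: sub_sigma_algebra.
exists [set A : 'M[R]_N | A i j < r].
  apply: (@open_comp _ R (fun A : 'M[R]_N => A i j) [set x | x < r]).
    by move=> A _; exact: coord_continuous.
  exact: open_lt.
by apply/seteqP; split=> A /=; rewrite in_itv.
Qed.

(** * The matrix pseudo-metrics and the measurability of their sublevel sets *)

Section dM.
Context (R : realType) (N : nat).

Definition dM_set (A B : 'M[R]_N) (rho : R) : Prop :=
  exists l : {set 'I_N}, #|l|%:R < N%:R * rho /\
    forall i j, i \notin l -> j \notin l -> `|A i j - B i j| < rho.

Lemma dM_setW A B r s : r <= s -> dM_set A B r -> dM_set A B s.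
Proof.
move=> rs [l [lr ABr]]; exists l; split.
  by apply: (lt_le_trans lr); rewrite ler_wpM2l.
by move=> i j il jl; apply: lt_le_trans rs; exact: ABr.
Qed.

(** With no index removed, any [rho] above all entry differences is admissible, for instance 1 plus
    their sum. For [N = 0] the strict bound on the cardinal has no solution. *)
Lemma dM_has_inf A B : (0 < N)%N ->
  has_inf [set rho | 0 < rho /\ dM_set A B rho].
Proof.
move=> N0; split; last by exists 0 => r [/ltW].
pose s := \sum_i \sum_j `|A i j - B i j|.
have s0 : 0 <= s by apply: sumr_ge0 => i _; exact: sumr_ge0.
exists (1 + s); split; first by rewrite ltr_wpDr.
exists finset.set0; split; first by rewrite cards0 mulr_gt0 ?ltr0n// ltr_wpDr.
move=> i j _ _; apply: (@le_lt_trans _ _ s); last by rewrite ltrDr.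
rewrite /s (bigD1 i)//= (bigD1 j)//= -addrA lerDl.
by apply: addr_ge0; apply: sumr_ge0 => *; rewrite ?sumr_ge0.
Qed.

Lemma dM_le A B r : 0 < r -> dM_set A B r -> dM A B <= r.
Proof. by move=> r0 ABr; apply: ge_inf => //; exists 0 => s [/ltW]. Qed.

Lemma dM_lt A B r : (0 < N)%N -> dM A B < r -> dM_set A B r.
Proof.
move=> N0; rewrite -subr_gt0 => r0.
have [s [_ ABs]] := inf_adherent r0 (dM_has_inf A B N0).
by rewrite addrC subrK => /ltW sr; exact: dM_setW ABs.
Qed.

(** The infimum need not be attained, hence the slack. Taking it along a sequence leaves countably
    many conditions, as measurability requires. *)
Lemma dM_leP A B r : (0 < N)%N -> 0 <= r ->
  dM A B <= r <-> forall n, dM_set A B (r + n.+1%:R^-1).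
Proof.
move=> N0 r0; split=> [ABr n|ABr].
  by apply: dM_lt => //; apply: (le_lt_trans ABr); rewrite ltrDl.
rewrite leNgt; apply/negP => /ltr_add_invr[n]; apply/negP; rewrite -leNgt.
by apply: dM_le; rewrite // ltr_wpDl.
Qed.

Lemma measurable_dM_le d (T : measurableType d) (f g : T -> 'M[R]_N) r :
  (0 < N)%N -> 0 <= r ->
  (forall i j, measurable_fun setT (fun t => f t i j)) ->
  (forall i j, measurable_fun setT (fun t => g t i j)) ->
  measurable [set t | dM (f t) (g t) <= r].
Proof.
move=> N0 r0 mf mg.
rewrite [X in measurable X](_ : _ = \bigcap_n
    \bigcup_(l in [set l : {set 'I_N} | #|l|%:R < N%:R * (r + n.+1%:R^-1)])
    \bigcap_(i in [set i | i \notin l]) \bigcap_(j in [set j | j \notin l])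
      [set t | `|f t i j - g t i j| < r + n.+1%:R^-1]).
  apply: bigcap_measurable => // n _.
  apply: fin_bigcup_measurable => // l _.
  apply: fin_bigcap_measurable => // i _.
  apply: fin_bigcap_measurable => // j _.
  rewrite (_ : [set t | _] = (fun t => `|f t i j - g t i j|) @^-1`
      `]-oo, (r + n.+1%:R^-1)[%classic).
    rewrite -[X in measurable X]setTI.
    have : measurable_fun setT (fun t => `|f t i j - g t i j|).
      by apply: measurableT_comp => //; exact: measurable_funB.
    exact.
  by apply/seteqP; split => t /=; rewrite in_itv.
apply/seteqP; split => [t /dM_leP - /(_ N0 r0) tr n _|t tr].
  have [l [lr ABl]] := tr n; exists l => // i il j jl; exact: ABl.
apply/dM_leP => // n; have [l lr ABl] := tr n I.
by exists l; split => // i j il jl; exact: ABl.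
Qed.

Lemma measurable_dpi_le d (T : measurableType d) (f g : T -> 'M[R]_N) r :
  (0 < N)%N -> 0 <= r ->
  (forall i j, measurable_fun setT (fun t => f t i j)) ->
  (forall i j, measurable_fun setT (fun t => g t i j)) ->
  measurable [set t | dpi (f t) (g t) <= r].
Proof.
move=> N0 r0 mf mg.
(* A minimum is at most [r] when one of its terms is; the default value of the big minimum counts as
   a term of its own. *)
rewrite [X in measurable X](_ : _ = [set t | dM (f t) (g t) <= r] `|`
    \bigcup_(s in [set: 'S_N])
      [set t | dM (f t) (row_perm s (col_perm s (g t))) <= r]).
  apply: measurableU; first exact: measurable_dM_le.
  apply: fin_bigcup_measurable => [|s _]; first exact: finite_finset.
  apply: measurable_dM_le => // i j.
  rewrite (_ : (fun t => _) = fun t => g t (s i) (s j)); first exact: mg.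
  by apply/funext => t; rewrite !mxE.
apply/seteqP; split => t /=; rewrite /dpi.
  rewrite leNgt; have [tr _|tr] := leP (dM (f t) (g t)) r; first by left.
  move/negP => h; right.
  apply: contrapT => nex; apply: h; apply/bigmin_gtP; split => // s _.
  by rewrite ltNge; apply/negP => sr; apply: nex; exists s.
case=> [|[s _] /=]; apply: le_trans; first exact: bigmin_le_id.
exact: bigmin_le_cond.
Qed.

End dM.

(** * The infima in the Prokhorov distance *)

Section Prokhorov.
Context d (T : measurableType d) (R : realType) (dist : T -> T -> R).
Implicit Types (mu nu : probability T R) (theta : probability (T * T)%type R).

(** The radius 1 is always admissible, so the infimum is not a default value. *)
Lemma coupling_defect_has_inf theta :
  has_inf [set r | 0 < r /\
    ((1 - r)%:E <= theta [set z | (dist z.1 z.2 <= r)%R])%E].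
Proof.
split; last by exists 0 => r [/ltW].
by exists 1; split => //; rewrite subrr measure_ge0.
Qed.

Lemma coupling_defect_ge0 theta : 0 <= coupling_defect dist theta.
Proof.
apply: lb_le_inf; first exact: (coupling_defect_has_inf theta).1.
by move=> r [/ltW].
Qed.

(** The product measure is a coupling. *)
Lemma dP_has_inf mu nu : has_inf [set coupling_defect dist theta |
  theta in is_coupling mu nu].
Proof.
split; last by exists 0 => _ [theta _ <-]; exact: coupling_defect_ge0.
exists (coupling_defect dist (mu \x nu)%E), (mu \x nu)%E => //.
split => A mA /=.
- rewrite (_ : fst @^-1` A = A `*` setT).
    by rewrite product_measure1E// [X in (_ * X)%E](probability_setT nu) mule1.
  by apply/seteqP; split => -[x y] //= [].
- rewrite (_ : snd @^-1` A = setT `*` A).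
    by rewrite product_measure1E// [X in (X * _)%E](probability_setT mu) mul1e.
  by apply/seteqP; split => -[x y] //= [].
Qed.

Lemma dP_ge0 mu nu : 0 <= dP dist mu nu.
Proof.
apply: lb_le_inf; first exact: (dP_has_inf mu nu).1.
by move=> _ [theta _ <-]; exact: coupling_defect_ge0.
Qed.

Lemma dP_le mu nu theta r : is_coupling mu nu theta -> 0 < r ->
  ((1 - r)%:E <= theta [set z | (dist z.1 z.2 <= r)%R])%E ->
  dP dist mu nu <= r.
Proof.
move=> munu r0 thetar; apply: (@le_trans _ _ (coupling_defect dist theta)).
  by apply: ge_inf; [exact: (dP_has_inf mu nu).2 | exists theta].
by apply: ge_inf; [exact: (coupling_defect_has_inf theta).2 | split].
Qed.

Lemma dP_lt mu nu e : dP dist mu nu < e ->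
  exists theta r, [/\ is_coupling mu nu theta, 0 < r, r < e &
    ((1 - r)%:E <= theta [set z | (dist z.1 z.2 <= r)%R])%E].
Proof.
rewrite -subr_gt0 => /inf_adherent /(_ (dP_has_inf mu nu)).
rewrite addrC subrK => -[_ [theta munu <-]].
rewrite -subr_gt0 => /inf_adherent /(_ (coupling_defect_has_inf theta)).
by rewrite addrC subrK => -[r [r0 thetar] re]; exists theta, r.
Qed.

(** Couplings see their marginals only through measurable sets; this spares an equality between
    bundled probabilities. *)
Lemma eq_dP mu nu mu' nu' : (forall A, measurable A -> mu A = mu' A) ->
  (forall A, measurable A -> nu A = nu' A) -> dP dist mu nu = dP dist mu' nu'.
Proof.
move=> mumu' nunu'; rewrite /dP; congr (inf (_ @` _)).
apply/seteqP; split => theta [th1 th2]; split => A mA.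
- by rewrite th1// mumu'.
- by rewrite th2// nunu'.
- by rewrite th1// mumu'.
- by rewrite th2// nunu'.
Qed.

End Prokhorov.

Lemma dGHP_has_inf (R : realType) (X Y : mmSpace R) :
  has_inf [set r : R | exists (Z : pmetricType R) (iX : X -> Z) (iY : Y -> Z)
      (hX : isometric_embedding iX) (hY : isometric_embedding iY),
    compact [set: Z] /\
    r = dP (T := borel Z) (@mdist R Z)
          (pushforward_prob (mm_measure X) (isometric_embedding_measurable hX))
          (pushforward_prob (mm_measure Y) (isometric_embedding_measurable hY))].
Proof.
split; last first.
  by exists 0 => _ [Z [iX [iY [hX [hY [_ ->]]]]]]; exact: dP_ge0.
(* Slices through the base points: the constant coordinate contributes 0 to the maximum. *)
have hX : @isometric_embedding R X (X * Y)%type (fun x => (x, point)).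
  by move=> x y; rewrite /mdist /= /sup_dist /= mdistxx max_l ?mdist_ge0.
have hY : @isometric_embedding R Y (X * Y)%type (fun y => (point, y)).
  by move=> x y; rewrite /mdist /= /sup_dist /= mdistxx max_r ?mdist_ge0.
eexists; exists (X * Y)%type, _, _, hX, hY; split => //.
by rewrite -setXTT; apply: compact_setX; exact: mm_compact.
Qed.

(** The Dirac mass at the base point turns [Z] into an [mmSpace], to which the known measurability
    applies. *)
Lemma measurable_sample_distmx (R : realType) (Z : pmetricType R) N :
  compact [set: Z] -> measurable_fun setT (@sample_distmx R Z N).
Proof.
by move=> cZ; exact: (@sample_distmx_measurable R (MMSpace cZ \d_point)).
Qed.

(** A sample and its isometric image have the same distance matrix. This moves both spaces into one
    common [Z]. *)
Lemma thetaN_isometry (R : realType) (X : mmSpace R) (Z : pmetricType R)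
    (cZ : compact [set: Z]) (i : X -> Z) (hi : isometric_embedding i) N A :
  measurable A ->
  thetaN (MMSpace cZ
    (pushforward_prob (mm_measure X) (isometric_embedding_measurable hi))) N A =
  thetaN X N A.
Proof.
move=> mA; rewrite /thetaN /= /distribution /pushforward /=.
rewrite -(prob_power_map (P := mm_measure X)
  (isometric_embedding_measurable hi))//.
  congr (prob_power _ _ _); apply/seteqP; split => x /=;
    congr A; apply: val_inj => /=; apply/matrixP => j k;
    by rewrite !mxE !tnth_map hi.
rewrite -[X in measurable X]setTI.
exact: measurable_sample_distmx.
Qed.

(** * Coupling the matrix laws by sampling pairs *)

Section sampling_coupling.
Context (R : realType) (Z : pmetricType R) (cZ : compact [set: Z]).
Context (mu nu : probability (borel Z) R).
Context (theta : probability (borel Z * borel Z)%type R) (N : nat).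

Definition sample_pair (t : N.-tuple (borel Z * borel Z)%type) :
    borel (distmx R N) * borel (distmx R N) :=
  (sample_distmx (map_tuple fst t), sample_distmx (map_tuple snd t)).

Lemma measurable_sample_pair : measurable_fun setT sample_pair.
Proof.
apply: measurable_fun_pair.
- apply: (measurableT_comp (@measurable_sample_distmx _ _ N cZ)).
  by apply: measurable_map_tuple; exact: measurable_fst.
- apply: (measurableT_comp (@measurable_sample_distmx _ _ N cZ)).
  by apply: measurable_map_tuple; exact: measurable_snd.
Qed.

Definition sample_coupling :=
  pushforward_prob (prob_power theta N) measurable_sample_pair.

Lemma sample_couplingP : is_coupling mu nu theta ->
  is_coupling (thetaN (MMSpace cZ mu) N) (thetaN (MMSpace cZ nu) N)
    sample_coupling.
Proof.
move=> [th1 th2]; split => A mA;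
  rewrite /thetaN /= /distribution /pushforward /=.
- rewrite -(prob_power_map measurable_fst th1)//.
  rewrite -[X in measurable X]setTI.
  exact: measurable_sample_distmx.
- rewrite -(prob_power_map measurable_snd th2)//.
  rewrite -[X in measurable X]setTI.
  exact: measurable_sample_distmx.
Qed.

Lemma dpi_sample_pair_le (t : N.-tuple (borel Z * borel Z)%type) (r s : R) :
  0 < s -> 2 * r < s ->
  #|[set i | tnth t i \in [set z | r < mdist (z.1 : Z) z.2]%classic]%SET|%:R
    < N%:R * s ->
  dpi_distmx (sample_pair t).1 (sample_pair t).2 <= s.
Proof.
(* The identity permutation suffices, since the samples are already matched by index; the removed
   indices are those of the distant pairs. *)
move=> s0 rs ts; apply: le_trans (bigmin_le_id _ _ _ _) _.
apply: dM_le => //; eexists; split; first exact: ts.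
have near i : i \notin [set i | tnth t i \in
    [set z | r < mdist (z.1 : Z) z.2]%classic]%SET ->
    mdist ((tnth t i).1 : Z) (tnth t i).2 <= r.
  by rewrite inE leNgt; apply: contra => ri; exact/mem_set.
move=> i j /near + /near; rewrite /sample_distmx /= !mxE !tnth_map /=.
case: (tnth t i) (tnth t j) => [x x'] [y y'] /= xx' yy'.
(* By the triangle inequality, replacing [x], [y] by [x'], [y'] changes their distance by at most
   [2 * r]. *)
apply: le_lt_trans rs; rewrite ler_norml; apply/andP; split.
  have := metric_triangle x' x y'; have := metric_triangle x y y'.
  rewrite (metric_sym x' x); lra.
have := metric_triangle x x' y; have := metric_triangle x' y' y.
rewrite (metric_sym y' y); lra.
Qed.

End sampling_coupling.

Lemma dP_thetaN_le (R : realType) (Z : pmetricType R) (cZ : compact [set: Z])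
    (mu nu : probability (borel Z) R)
    (theta : probability (borel Z * borel Z)%type R) N (r : R) :
  (0 < N)%N -> 0 < r -> r < 1 / 4 -> is_coupling mu nu theta ->
  ((1 - r)%:E <= theta [set z | (mdist (z.1 : Z) z.2 <= r)%R])%E ->
  dP (@dpi_distmx R N) (thetaN (MMSpace cZ mu) N) (thetaN (MMSpace cZ nu) N)
    <= Num.sqrt r.
Proof.
move=> N0 r0 r4 munu thr.
set s := Num.sqrt r.
have s0 : 0 < s by rewrite sqrtr_gt0.
have rE : r = s * s by rewrite -expr2 sqr_sqrtr// ltW.
(* From [s * s < 1 / 4] follows [s < 1 / 2], hence [2 * (s * s) < s]. *)
have rs : 2 * r < s by rewrite rE; move: r4; rewrite rE; nra.
have thN := sample_couplingP cZ N munu.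
apply: (dP_le thN) => //.
pose B : set (borel Z * borel Z) := [set z | r < mdist (z.1 : Z) z.2].
have md := measurable_mdist cZ.
have mB : measurable B.
  rewrite (_ : B = (fun z => mdist (z.1 : Z) z.2) @^-1` `]r, +oo[%classic).
    by rewrite -[X in measurable X]setTI; exact: md.
  by apply/seteqP; split => z /=; rewrite in_itv/= andbT.
have thB : (theta B <= r%:E)%E.
  have BE : [set z : borel Z * borel Z | (mdist (z.1 : Z) z.2 <= r)%R] = ~` B.
    by apply/seteqP; split => z /=; rewrite /B /= leNgt => /negP.
  move: thr; rewrite BE probability_setC//.
  rewrite -(fineK (fin_num_measure theta B mB)); set b := fine _.
  by rewrite -[(1 - b%:E)%E]/((1 - b)%:E) !lee_fin; lra.
pose bad := [set t : N.-tuple (borel Z * borel Z)%type |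
  N%:R * s <= #|[set i | tnth t i \in B]%SET|%:R].
have Ns0 : 0 < N%:R * s by rewrite mulr_gt0 ?ltr0n.
have badE : ~` bad = [set t : N.-tuple (borel Z * borel Z)%type |
  #|[set i | tnth t i \in B]%SET|%:R < N%:R * s].
  by apply/seteqP; split => t /=; rewrite /bad /= ltNge => /negP.
have mbad : measurable bad.
  rewrite (_ : bad = (fun t => #|[set i | tnth t i \in B]%SET|%:R) @^-1`
      `[(N%:R * s), +oo[%classic).
    by rewrite -[X in measurable X]setTI; exact: measurable_card_tnth.
  by apply/seteqP; split => t /=; rewrite /bad in_itv /= andbT.
(* Markov bounds [N * s] times this probability by [N * r], which is [(N * s) * s]; the positive
   factor [N * s] cancels. *)
have bads : (prob_power theta N bad <= s%:E)%E.
  have := prob_power_markov theta N mB Ns0.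
  rewrite -/bad => /le_trans /(_ (lee_wpmul2l _ thB)).
  rewrite lee_fin => /(_ (ler0n _ _)).
  rewrite -(fineK (fin_num_measure (prob_power theta N) bad mbad)).
  set b := fine _; rewrite -!EFinM !lee_fin rE.
  by rewrite mulrA ler_pM2l.
rewrite /= /distribution /pushforward /=.
apply: (@le_trans _ _ (prob_power theta N (~` bad))).
  rewrite probability_setC//; move: bads.
  rewrite -(fineK (fin_num_measure (prob_power theta N) bad mbad)).
  set b := fine _; rewrite -[(1 - b%:E)%E]/((1 - b)%:E) !lee_fin; lra.
apply: le_measure; rewrite ?inE.
- exact: measurableC.
- rewrite -[X in measurable X]setTI; apply: measurable_sample_pair => //.
  apply: measurable_dpi_le => // [|i j|i j]; first exact: ltW.
    exact: measurableT_comp (distmx_coord_measurable i j) measurable_fst.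
  exact: measurableT_comp (distmx_coord_measurable i j) measurable_snd.
- by rewrite badE => t tB; exact: dpi_sample_pair_le rs tB.
Qed.

Theorem theorem7p1 (R : realType) (X Y : mmSpace R) (hXY : dGHP X Y < 1 / 4)
    (N : nat) (hN : (1 <= N)%N) :
  dP (@dpi_distmx R N) (thetaN X N) (thetaN Y N) <= Num.sqrt (dGHP X Y).
Proof.
have G0 : 0 <= dGHP X Y.
  apply: lb_le_inf; first exact: (dGHP_has_inf X Y).1.
  by move=> _ [Z [iX [iY [hX [hY [_ ->]]]]]]; exact: dP_ge0.
(* The infimum over common spaces need not be attained, so the bound is proved above it first; the
   cap on [e] keeps the chosen [r] below 1/4. *)
have key e : dGHP X Y < e -> e <= 1 / 4 ->
    dP (@dpi_distmx R N) (thetaN X N) (thetaN Y N) <= Num.sqrt e.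
  rewrite -subr_gt0 => /inf_adherent /(_ (dGHP_has_inf X Y)).
  rewrite addrC subrK => -[_ [Z [iX [iY [hX [hY [cZ ->]]]]]]].
  move=> /dP_lt[theta [r [munu r0 re thr]]] e4.
  apply: (@le_trans _ _ (Num.sqrt r)); last by rewrite ler_wsqrtr// ltW.
  have := dP_thetaN_le cZ hN r0 (lt_le_trans re e4) munu thr.
  by rewrite (eq_dP _ (thetaN_isometry cZ hX (N := N))
    (thetaN_isometry cZ hY (N := N))).
rewrite leNgt; apply/negP => lt_dP.
set D := dP _ _ _ in key lt_dP.
have D0 : 0 <= D by exact: dP_ge0.
(* If the claim failed, [D ^+ 2] would exceed [dGHP X Y]. The midpoint of the two, capped at 1/4, is
   then admissible in [key] and has square root below [D], a contradiction. *)
pose e := Num.min (1 / 4) ((dGHP X Y + D ^+ 2) / 2).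
have GD : dGHP X Y < D ^+ 2.
  by rewrite -(sqr_sqrtr G0) ltr_pXn2r// nnegrE sqrtr_ge0.
have Ge : dGHP X Y < e by rewrite lt_min hXY/=; lra.
have := key e Ge; rewrite ge_min lexx => /(_ isT).
apply/negP; rewrite -ltNge.
rewrite -[ltRHS]ger0_norm// -sqrtr_sqr ltr_sqrt; last by lra.
by rewrite gt_min; apply/orP; right; lra.
Qed.
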